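(* Let $G$ be a finite group. Then the following hold: 1) if $G$ is strongly supersoluble, then every subgroup of $G$ is strongly supersoluble; 2) if $G$ is strongly supersoluble and $N\unlhd G$, then $G/N$ is strongly supersoluble; 3) if $N_i\unlhd G$ and $G/N_i$ is strongly supersoluble for $i=1,2$, then $G/(N_1\cap N_2)$ is strongly supersoluble; 4) if $H_i\unlhd G$ and $H_i$ is strongly supersoluble for $i=1,2$, and $H_1\cap H_2=1$, then $H_1\times H_2$ is strongly supersoluble; 5) if $G/\Phi(G)$ is strongly supersoluble, then $G$ is strongly supersoluble; 6) the class $s\mathfrak{U}$ of all strongly supersoluble groups is a hereditary saturated formation.
   Context: All groups are finite. A subgroup $M$ of a group $G$ is called modular in $G$ if: (1) $\langle X, M\cap Z\rangle=\langle X,M\rangle\cap Z$ for all $X\le G$, $Z\le G$ with $X\le Z$; and (2) $\langle M, Y\cap Z\rangle=\langle M,Y\rangle\cap Z$ for all $Y\le G$, $Z\le G$ with $M\le Z$. A subgroup $H$ of $G$ is called submodular in $G$ if there is a chain of subgroups $H=H_0\le H_1\le\dots\le H_s=G$ such that $H_{i-1}$ is modular in $H_i$ for $i=1,\dots,s$. A group is called strongly supersoluble if it is supersoluble and every Sylow subgroup of it is submodular in it. $\Phi(G)$ denotes the Frattini subgroup of $G$. A class of groups (closed under isomorphism) $\mathfrak{F}$ is a formation if (a) every quotient of a group in $\mathfrak{F}$ lies in $\mathfrak{F}$, and (b) whenever $A,B$ are normal subgroups of a group $H$ with $H/A\in\mathfrak{F}$ and $H/B\in\mathfrak{F}$, then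 $H/(A\cap B)\in\mathfrak{F}$. A formation $\mathfrak{F}$ is hereditary if it contains all subgroups of each of its members, and saturated if $G/\Phi(G)\in\mathfrak{F}$ implies $G\in\mathfrak{F}$. *)

(* Defs.v *)
From mathcomp Require Import all_boot all_fingroup all_solvable.

Set Implicit Arguments.
Unset Strict Implicit.
Unset Printing Implicit Defensive.

Local Open Scope group_scope.

Definition modular (gT : finGroupType) (M G : {group gT}) : bool :=
  [&& M \subset G,
      [forall X : {group gT}, forall Z : {group gT},
         [&& X \subset G, Z \subset G & X \subset Z] ==>
           (X <*> (M :&: Z) == (X <*> M) :&: Z)]
    & [forall Y : {group gT}, forall Z : {group gT},
         [&& Y \subset G, Z \subset G & M \subset Z] ==>
           (M <*> (Y :&: Z) == (M <*> Y) :&: Z)]].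

Definition submodular (gT : finGroupType) (H G : {group gT}) : Prop :=
  exists2 s : seq {group gT}, path (@modular gT) H s & last H s = G.

(* A series 1 = K_0 <= K_1 <= ... <= K_n = G of normal subgroups of G (not
   merely a subnormal one) with cyclic factors K_i / K_{i-1}. *)
Definition supersoluble (gT : finGroupType) (G : {group gT}) : Prop :=
  exists2 s : seq {group gT},
    path [rel H K : {group gT} |
            [&& H \subset K, H <| G, K <| G & cyclic (K / H)]] 1%G s
    & last 1%G s = G.

Definition strongly_supersoluble (gT : finGroupType) (G : {group gT}) : Prop :=
  supersoluble G /\
  (forall (p : nat) (P : {group gT}),
     prime p -> p.-Sylow(G) P -> submodular P G).

(* A collection of finite groups; a group here is a {group gT} in an arbitrary
   ambient finGroupType, so invariance under \isog is what makes it a class of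
   abstract groups. *)
Definition group_collection : Type :=
  forall gT : finGroupType, {group gT} -> Prop.

Definition isog_closed (F : group_collection) : Prop :=
  forall (gT rT : finGroupType) (G : {group gT}) (H : {group rT}),
    G \isog H -> F gT G -> F rT H.

Definition formation (F : group_collection) : Prop :=
  [/\ isog_closed F,
      forall (gT : finGroupType) (G N : {group gT}),
        N <| G -> F gT G -> F _ (G / N)%G
    & forall (gT : finGroupType) (H A B : {group gT}),
        A <| H -> B <| H -> F _ (H / A)%G -> F _ (H / B)%G ->
        F _ (H / (A :&: B))%G].

Definition hereditary (F : group_collection) : Prop :=
  forall (gT : finGroupType) (G H : {group gT}),
    H \subset G -> F gT G -> F gT H.

Definition saturated (F : group_collection) : Prop :=
  forall (gT : finGroupType) (G : {group gT}),
    F _ (G / 'Phi(G))%G -> F gT G.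

(* Main.v *)
Require Import Defs.
From mathcomp Require Import all_boot all_fingroup all_solvable.
From mathcomp Require Import ssralg poly polydiv matrix mxalgebra mxpoly.
From mathcomp Require Import finalg zmodp finfield mxrepresentation mxabelem.

(* A group G is strongly supersoluble iff each of its proper normal subgroups N
   lies under a normal subgroup M of G with M / N of prime order and
   G / C_G(M / N) of squarefree order.  If q^2 divided the order of that
   automizer, a Sylow q-subgroup Q would be modular in PQ, for P of prime order
   in a quotient of G, and this contradicts the modular law; conversely, Sylow
   subgroups are submodular by induction through a minimal normal subgroup.
   This criterion passes easily to subgroups, quotients and subdirect products.
   For saturation one may assume that any two nontrivial normal subgroups meet,
   so that O_p'(G) = 1 for some p with Phi(G) a p-group.  Then G / O_p(G) is
   abelian of squarefree exponent dividing p - 1; since O_p(G) centralizes the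
   minimal normal subgroup M, the polynomial X^p - X splits M into common
   eigenspaces, whence M has order p and a squarefree automizer. *)

Set Implicit Arguments.
Unset Strict Implicit.
Unset Printing Implicit Defensive.
Set Bullet Behavior "Strict Subproofs".

Import GRing.Theory.

Local Open Scope group_scope.

(** * Modular and submodular subgroups *)

Lemma modularP (gT : finGroupType) (M G : {group gT}) :
  reflect [/\ M \subset G,
              forall X Z : {group gT}, Z \subset G -> X \subset Z ->
                X <*> (M :&: Z) = (X <*> M) :&: Z
            & forall Y Z : {group gT}, Y \subset G -> Z \subset G ->
                M \subset Z -> M <*> (Y :&: Z) = (M <*> Y) :&: Z]
          (modular M G).
Proof.
apply: (iffP and3P) => [[sMG m1 m2] | [sMG m1 m2]]; split=> //.
- move=> X Z sZG sXZ; have/forallP/(_ X)/forallP/(_ Z) := m1.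
  by rewrite sZG sXZ (subset_trans sXZ sZG) => /eqP.
- move=> Y Z sYG sZG sMZ; have/forallP/(_ Y)/forallP/(_ Z) := m2.
  by rewrite sYG sZG sMZ => /eqP.
- apply/forallP=> X; apply/forallP=> Z; apply/implyP=> /and3P[_ sZG sXZ].
  by rewrite m1.
- apply/forallP=> Y; apply/forallP=> Z; apply/implyP=> /and3P[sYG sZG sMZ].
  by rewrite m2.
Qed.

(** For [X] inside [G :&: U], law one with [Z := G :&: U] turns the join with [M :&: U] into the
    join with [M] cut down to [G :&: U]. Both laws then reduce to those for [M]; in the second, [Z]
    is replaced by [M <*> Z], which cuts back to [Z]. *)
Lemma modularI (gT : finGroupType) (M G U : {group gT}) :
  modular M G -> modular (M :&: U)%G (G :&: U)%G.
Proof.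
case/modularP=> sMG m1 m2.
have m1U (X : {group gT}) : X \subset G :&: U ->
    X <*> (M :&: U) = (X <*> M) :&: (G :&: U).
  move=> sX; rewrite -(m1 X (G :&: U)%G) ?subsetIl //=.
  by rewrite setIA (setIidPl sMG).
apply/modularP; split=> /= [|X Z sZ sXZ|Y Z sY sZ sMZ].
- exact: setSI.
- have [sZG sZU] := subsetIP sZ.
  rewrite -setIA (setIidPr sZU) m1 // m1U ?(subset_trans sXZ) //.
  by rewrite -setIA (setIidPr sZ).
- have [sYG sYU] := subsetIP sY; have [sZG sZU] := subsetIP sZ.
  have defZ : (M <*> Z) :&: (G :&: U) = Z.
    by rewrite [M <*> Z]joingC -m1U //; apply/joing_idPl.
  have sYZ : (Y :&: Z)%G \subset G :&: U by rewrite subIset ?sY.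
  have sMZG : M <*> Z \subset G by rewrite join_subG sMG.
  rewrite joingC (m1U (Y :&: Z)%G) // [(M :&: U) <*> Y]joingC m1U //.
  have := m2 Y (M <*> Z)%G sYG sMZG (joing_subl _ _).
  rewrite /= -[in Y :&: _](setIidPl sY) -setIA [_ :&: (M <*> Z)]setIC defZ.
  rewrite ![M <*> _]joingC => ->.
  by rewrite -setIA [Z <*> M]joingC defZ -setIA (setIidPr sZ).
Qed.

Lemma modular_morphim (aT rT : finGroupType) (D : {group aT})
    (f : {morphism D >-> rT}) (M G : {group aT}) :
  G \subset D -> modular M G -> modular (f @* M)%G (f @* G)%G.
Proof.
move=> sGD /modularP[sMG m1 m2]; have sMD := subset_trans sMG sGD.
have liftS (L : {group rT}) : L \subset f @* G -> f @* (G :&: f @*^-1 L) = L.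
  by move=> sLG; rewrite morphim_setIpre (setIidPr sLG).
have meet_lift (L : {group rT}) : L \subset f @* G ->
    forall B : {set aT}, B \subset G ->
    f @* B :&: L = f @* (B :&: (G :&: f @*^-1 L)).
  by move=> sLG B sBG; rewrite setIA (setIidPl sBG) morphim_setIpre.
have sDI (A B : {set aT}) : A \subset D -> A :&: B \subset D.
  exact: subset_trans (subsetIl A B).
apply/modularP; split=> /= [|X Z sZG sXZ|Y Z sYG sZG sMZ].
- exact: morphimS.
- have sXG := subset_trans sXZ sZG.
  rewrite -(liftS X) // meet_lift // -morphimY ?sDI //.
  rewrite (m1 (G :&: f @*^-1 X)%G (G :&: f @*^-1 Z)%G) ?subsetIl //=;
    last by rewrite setIS ?morphpreS.
  rewrite -morphimY ?sDI // meet_lift //.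
  by rewrite join_subG subsetIl.
- rewrite -(liftS Y) // meet_lift ?subsetIl // -morphimY ?sDI //.
  rewrite (m2 (G :&: f @*^-1 Y)%G (G :&: f @*^-1 Z)%G) ?subsetIl //=;
    last by rewrite subsetI sMG -sub_morphim_pre.
  by rewrite -morphimY ?sDI // meet_lift // join_subG sMG subsetIl.
Qed.

(** In law two both sides contain ['ker f], so comparing their images is enough. In law one [X] may
    miss part of the kernel: an element [z] of the right side has the same image as some [w] of the
    left side, and [z * w^-1] lies in the kernel and in [Z], hence in [f @*^-1 M :&: Z]. *)
Lemma modular_morphpre (aT rT : finGroupType) (D : {group aT})
    (f : {morphism D >-> rT}) (M G : {group rT}) :
  G \subset f @* D -> modular M G -> modular (f @*^-1 M)%G (f @*^-1 G)%G.
Proof.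
move=> sGD /modularP[sMG m1 m2]; have sMD := subset_trans sMG sGD.
have sKM : 'ker f \subset f @*^-1 M by apply: ker_sub_pre.
have im_pre (L : {group aT}) : L \subset f @*^-1 G -> f @* L \subset G.
  by move=> sLG; rewrite -(morphpreK sGD) morphimS.
have sD (L : {group aT}) : L \subset f @*^-1 G -> L \subset D.
  by move=> sLG; apply: subset_trans sLG (subsetIl _ _).
apply/modularP; split=> /= [|X Z sZG sXZ|Y Z sYG sZG sMZ].
- exact: morphpreS.
- have sXG := subset_trans sXZ sZG; have sZD := sD _ sZG; have sXD := sD _ sXG.
  have sMZD : f @*^-1 M :&: Z \subset D by rewrite subIset ?sZD ?orbT.
  apply/eqP; rewrite eqEsubset; apply/andP; split.
    rewrite subsetI genS ?setUS ?subsetIl //=.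
    by rewrite join_subG sXZ subsetIr.
  apply/subsetP=> z /setIP[XMz Zz]; set W := X <*> _.
  have: f z \in f @* W.
    rewrite morphimY // setIC morphim_setIpre setIC (m1 (f @* X)%G (f @* Z)%G);
      rewrite ?morphimS ?im_pre //.
    rewrite inE mem_morphim ?(subsetP sZD) // andbT.
    rewrite -(morphpreK sMD) -morphimY ?subsetIl // mem_morphim //.
    exact: (subsetP sZD).
  case/morphimP=> w Dw Ww fzw.
  have sWZ : W \subset Z by rewrite join_subG sXZ subsetIr.
  rewrite -(mulgKV w z) groupMr //.
  have Dz := subsetP sZD z Zz.
  apply: (subsetP (joing_subr _ _)); apply/setIP; split; last first.
    by rewrite groupM ?groupV // (subsetP sWZ).
  apply: (subsetP sKM); apply/kerP; first by rewrite groupM ?groupV.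
  by rewrite morphM ?groupV // morphV // fzw mulgV.
- have sZD := sD _ sZG; have sYD := sD _ sYG.
  have sKZ := subset_trans sKM sMZ.
  have sYZD : Y :&: Z \subset D by rewrite subIset ?sYD.
  have sMYD : f @*^-1 M <*> Y \subset D by rewrite join_subG subsetIl.
  have sMYZD : f @*^-1 M <*> (Y :&: Z) \subset D by rewrite join_subG subsetIl.
  have sKpM := subset_trans sKM (joing_subl (f @*^-1 M) _).
  apply: (@morphim_inj _ _ _ f (f @*^-1 M <*> (Y :&: Z))%G
                               ((f @*^-1 M <*> Y) :&: Z)%G) => /=.
  + by rewrite sKpM.
  + by rewrite subsetI sKpM sKZ subIset ?sMYD.
  + rewrite morphimIG // !morphimY ?subsetIl // morphimIG // morphpreK //.
    rewrite (m2 (f @* Y)%G (f @* Z)%G) ?im_pre //.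
    by rewrite -(morphpreK sMD) morphimS.
Qed.

Lemma modular1 (gT : finGroupType) (G : {group gT}) : modular 1%G G.
Proof.
apply/modularP; split=> [|X Z _ sXZ|Y Z _ _ _]; first exact: sub1G.
- by rewrite (setIidPl (sub1G Z)) !joingG1 (setIidPl sXZ).
- by rewrite !joing1G.
Qed.

Lemma submodular_refl (gT : finGroupType) (G : {group gT}) : submodular G G.
Proof. by exists [::]. Qed.

Lemma submodular_trans (gT : finGroupType) (K H G : {group gT}) :
  submodular H K -> submodular K G -> submodular H G.
Proof.
move=> [s Hs <-] [t tG <-]; exists (s ++ t); last by rewrite last_cat.
by rewrite cat_path Hs.
Qed.

Lemma modular_submodular (gT : finGroupType) (H G : {group gT}) :
  modular H G -> submodular H G.
Proof. by move=> mHG; exists [:: G]; rewrite //= mHG. Qed.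

Lemma submodular_ind (gT : finGroupType) (P : {group gT} -> Prop)
    (G : {group gT}) :
    P G ->
    (forall H K : {group gT}, modular H K -> submodular K G -> P K -> P H) ->
  forall H, submodular H G -> P H.
Proof.
move=> PG Pstep H [s]; elim: s H => [|K s IHs] H /= => [_ -> //|].
case/andP=> mHK sK lastG; apply: (Pstep H K) => //; last exact: IHs.
by exists s.
Qed.

Lemma submodular_sub (gT : finGroupType) (H G : {group gT}) :
  submodular H G -> H \subset G.
Proof.
elim/submodular_ind: H / => // H K /modularP[sHK _ _] _.
exact: subset_trans.
Qed.

Lemma submodularI (gT : finGroupType) (H G U : {group gT}) :
  submodular H G -> submodular (H :&: U)%G (G :&: U)%G.
Proof.
elim/submodular_ind: H / => [|H K mHK _]; first exact: submodular_refl.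
exact/submodular_trans/modular_submodular/modularI.
Qed.

Lemma submodular_morphim (aT rT : finGroupType) (D : {group aT})
    (f : {morphism D >-> rT}) (H G : {group aT}) :
  G \subset D -> submodular H G -> submodular (f @* H)%G (f @* G)%G.
Proof.
move=> sGD; elim/submodular_ind: H / => [|H K mHK sKG].
  exact: submodular_refl.
apply/submodular_trans/modular_submodular/modular_morphim=> //.
exact: subset_trans (submodular_sub sKG) sGD.
Qed.

Lemma submodular_morphpre (aT rT : finGroupType) (D : {group aT})
    (f : {morphism D >-> rT}) (H G : {group rT}) :
  G \subset f @* D -> submodular H G ->
  submodular (f @*^-1 H)%G (f @*^-1 G)%G.
Proof.
move=> sGD; elim/submodular_ind: H / => [|H K mHK sKG].
  exact: submodular_refl.
apply/submodular_trans/modular_submodular/modular_morphpre=> //.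
exact: subset_trans (submodular_sub sKG) sGD.
Qed.

Lemma submodular_quotient_inv (gT : finGroupType) (N H G : {group gT}) :
  N <| G -> N \subset H -> H \subset G ->
  submodular (H / N)%G (G / N)%G -> submodular H G.
Proof.
move=> nsNG sNH sHG /(submodular_morphpre (sub_im_coset _)).
have nsNH := normalS sNH sHG nsNG.
have -> : (coset N @*^-1 (H / N))%G = H by apply: val_inj; apply: quotientGK.
by have -> : (coset N @*^-1 (G / N))%G = G by apply: val_inj; apply: quotientGK.
Qed.

(** By maximality the chain only visits [M] and [G], and the step at which it leaves [M] is the
    claim. *)
Lemma submodular_maximal (gT : finGroupType) (M G : {group gT}) :
  maximal M G -> submodular M G -> modular M G.
Proof.
move=> maxM subM; elim/submodular_ind: M / subM maxM => [|H K mHK sKG IH maxH].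
  by case/maxgroupp/andP; rewrite subxx.
have [eqHK|neqHK] := eqVneq H K; first by rewrite eqHK in maxH *; apply: IH.
have [<- // | neqKG] := eqVneq K G.
have [sHK _ _] := modularP _ _ mHK; have [_ maxH'] := maxgroupP maxH.
case/eqP: neqHK; apply/val_inj/esym/maxH' => //.
by rewrite properEneq (submodular_sub sKG) andbT.
Qed.

(** * Automizers of normal subgroups of prime order *)

Definition squarefree n := forall q, prime q -> ~~ (q ^ 2 %| n).

Lemma squarefree_dvd m n : m %| n -> squarefree n -> squarefree m.
Proof. by move=> dvmn sqn q /sqn; apply/contraNN => /dvdn_trans->. Qed.

Lemma squarefree_pnat q n :
  prime q -> q.-nat n -> squarefree n -> n %| q.
Proof.
move=> q_pr /p_natP[[|[|k]] ->]; rewrite ?dvd1n ?dvdnn // => /(_ q q_pr).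
by rewrite dvdn_exp2l.
Qed.

Lemma automizer_isog (gT : finGroupType) (P G : {group gT}) :
    G \subset 'N(P) ->
  exists2 A : {group {perm gT}}, G / 'C_G(P) \isog A & A \subset Aut P.
Proof.
move=> nPG; have := first_isog_loc (conj_aut_morphism P) nPG.
rewrite ker_conj_aut => iso; exists (conj_aut P @* G)%G => //.
exact: Aut_conj_aut.
Qed.

Lemma automizer_prime_cyclic (gT : finGroupType) (P G : {group gT}) :
  G \subset 'N(P) -> prime #|P| -> cyclic (G / 'C_G(P)).
Proof.
move=> nPG prP; have [A iso sA] := automizer_isog nPG.
by rewrite (isog_cyclic iso) (cyclicS sA) ?Aut_prime_cyclic.
Qed.

Lemma automizer_prime_dvd (gT : finGroupType) (P G : {group gT}) :
  G \subset 'N(P) -> prime #|P| -> #|G : 'C_G(P)| %| #|P|.-1.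
Proof.
move=> nPG prP; have [A iso sA] := automizer_isog nPG.
rewrite -card_quotient ?normsI ?normG ?norms_cent // (card_isog iso).
rewrite (dvdn_trans (cardSg sA)) // card_Aut_cyclic ?prime_cyclic //.
by rewrite totient_prime.
Qed.

(* If q^2 divided the index, a maximal subgroup X of a conjugate Q^x containing
   'C_Q(P) = Q :&: Q^x would violate the modular law for Q in PQ. *)
Lemma squarefree_automizer (gT : finGroupType) (G P : {group gT}) :
    P <| G -> prime #|P| ->
    (forall (q : nat) (Q : {group gT}),
       prime q -> q.-Sylow(G) Q -> submodular Q G) ->
  squarefree #|G : 'C_G(P)|.
Proof.
move=> nsPG prP submodS q q_pr; apply/negP=> q2_dv.
have [sPG nPG] := andP nsPG.
(* The index divides [#|P|.-1], which is positive and smaller than the square of [#|P|]. *)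
have q'P : q != #|P|.
  apply: contraTneq (dvdn_trans q2_dv (automizer_prime_dvd nPG prP)) => ->.
  rewrite gtnNdvd // ?(leq_ltn_trans (leq_pred _)) //.
    by rewrite -subn1 subn_gt0 prime_gt1.
  by rewrite -[X in X < _]expn1 ltn_exp2l // prime_gt1.
have [Q sylQ] := Sylow_exists q G; have [sQG qQ _] := and3P sylQ.
have nPQ := subset_trans sQG nPG.
have tiPQ : P :&: Q = 1.
  apply: coprime_TIg; rewrite coprime_sym (pnat_coprime qQ) //.
  by rewrite pnatE // !inE eq_sym.
have q2_dvQ : q ^ 2 %| #|Q : 'C_Q(P)|.
  have nsCG : 'C_G(P) <| G.
    by rewrite /normal subsetIl normsI ?normG ?norms_cent.
  have defCQ : 'C_Q(P) = Q :&: 'C_G(P) by rewrite setIA (setIidPl sQG).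
  have [_ nCG] := andP nsCG; have nCQ := subset_trans sQG nCG.
  rewrite defCQ indexgI -card_quotient // pfactor_dvdn //.
  have := quotient_pHall nCQ sylQ => /card_Hall ->.
  rewrite p_part pfactorK // -pfactor_dvdn ?cardG_gt0 //.
  by rewrite card_quotient.
pose R := (P <*> Q)%G.
have sQR : Q \subset R by apply: joing_subr.
have maxQ : maximal Q R.
  apply: p_index_maximal => //.
  have -> : #|R : Q| = #|P| => //.
  rewrite -divgS //= norm_joinEr // TI_cardMg // mulnK //.
have sRG : R \subset G by rewrite join_subG sPG.
have modQ : modular Q R.
  apply: submodular_maximal => //.
  have := submodularI R (submodS q Q q_pr sylQ).
  have -> : (Q :&: R)%G = Q by apply: val_inj; apply/setIidPl.
  by have -> : (G :&: R)%G = R by apply: val_inj; apply/setIidPr.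
have [x Px ntx] : exists2 x, x \in P & x != 1.
  by apply/trivgPn; rewrite -cardG_gt1 prime_gt1.
have defP : <[x]> = P.
  apply/eqP; rewrite eqEcard cycle_subG Px /= dvdn_leq //.
  have /primeP[_ /(_ #[x])] := prP; rewrite order_dvdG // => /(_ isT).
  by rewrite order_eq1 (negPf ntx) /= => /eqP; rewrite /order => ->.
have sCQ : 'C_Q(P) \subset Q :^ x.
  apply/subsetP=> y /setIP[Qy /centP cPy]; rewrite mem_conjg.
  rewrite conjgE invgK mulgA.
  by rewrite -(cPy x Px) mulgK.
(* For [y] in both conjugates, [[~ y, x^-1]] lies in [Q], and in [P] since [Q] normalizes [P]; so it
   is trivial and [y] commutes with the generator [x] of [P]. *)
have sQQx : Q :&: Q :^ x \subset 'C_Q(P).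
  apply/subsetP=> y /setIP[Qy]; rewrite mem_conjg => Qz.
  have: [~ y, x^-1] \in P :&: Q.
    apply/setIP; split; last by rewrite commgEl groupMl ?groupV.
    by rewrite commgEr invgK groupMr ?groupV // memJ_norm // (subsetP nPQ).
  rewrite tiPQ => /set1P/eqP/commgP=> cyx.
  rewrite inE Qy /= -defP cent_cycle; apply/cent1P.
  by rewrite -[x]invgK; apply: commuteV.
have q_gt1 := prime_gt1 q_pr.
have q2_ndvq : q ^ 2 %| q = false.
  by apply: gtnNdvd; rewrite ?prime_gt0 // -[X in X < _]expn1 ltn_exp2l.
have q2_dvQx : q ^ 2 %| #|Q :^ x : 'C_Q(P)|.
  by rewrite -divgS // cardJg divgS ?subsetIl.
have qQx : q.-group (Q :^ x) by rewrite pgroupJ.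
have [eqCQ|[X maxX sCX]] := maximal_exists sCQ.
  by move: q2_dvQx; rewrite -eqCQ indexgg dvdn1 -(expn0 q) eqn_exp2l.
(* Here the square matters: [X] has index [q] in [Q :^ x], whereas [q ^ 2] divides the index of
   ['C_Q(P)]. *)
have neqCX : 'C_Q(P) != X.
  apply: contraL q2_dvQx => /eqP->; rewrite (p_maximal_index qQx maxX).
  by rewrite q2_ndvq.
have [sXQx not_sQxX] := andP (maxgroupp maxX).
have not_sXQ : ~~ (X \subset Q).
  apply: contra neqCX => sXQ; rewrite eqEsubset sCX.
  by rewrite (subset_trans _ sQQx) // subsetI sXQ.
have sQxR : Q :^ x \subset R.
  by rewrite -(conjGid (_ : x \in R)) ?conjSg ?(subsetP (joing_subl _ _)).
have defR : X <*> Q = R.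
  have /maximal_eqP[_ /(_ (X <*> Q)%G)] : maximal_eq Q R.
    by rewrite /maximal_eq maxQ orbT.
  rewrite joing_subr join_subG sQR (subset_trans sXQx) //.
  move=> /(_ isT isT)[eqQ|-> //].
  by case/negP: not_sXQ; rewrite -eqQ joing_subl.
(* Law one for [X] inside [Q :^ x] reads [X <*> (Q :&: Q :^ x) = Q :^ x], but the left side is just
   [X], a proper subgroup of [Q :^ x]. *)
have [_ m1 _] := modularP _ _ modQ.
have := m1 X (Q :^ x)%G sQxR sXQx; rewrite /= defR (setIidPr sQxR) => eqX.
by case/negP: not_sQxX; rewrite /= -eqX join_subG subxx (subset_trans sQQx).
Qed.

(** * Factors of prime order with squarefree automizer *)

(** [C] stands in for the centralizer of [M / N] in [G], whose index divides that of [C]. Asking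
    only for some such [C] lets the condition pass through morphisms without computing centralizers
    in quotients. *)
Definition sqf_factor (gT : finGroupType) (G N M : {group gT}) : Prop :=
  [/\ N <| G, M <| G, N \subset M & prime #|M : N|] /\
  exists C : {group gT},
    [/\ C <| G, [~: M, C] \subset N & squarefree #|G : C|].

(* [sqf_above G 1] is the chief-series description of strongly supersoluble
   groups, and [sqf_above G K] is the same condition for [G / K]. *)
Definition sqf_above (gT : finGroupType) (G K : {group gT}) : Prop :=
  forall N : {group gT}, N <| G -> K \subset N -> ~~ (G \subset N) ->
  exists M, sqf_factor G N M.

(* [M] is the product of [N] and [A :&: M0], where [M0] is a factor above a
   normal [L >= K] of [G] that is maximal subject to [A :&: L \subset N]. *)
Lemma sqf_factorI (gT : finGroupType) (G K H A N : {group gT}) :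
    sqf_above G K -> K <| G -> H \subset G -> A <| H -> N <| H ->
    A :&: K \subset N -> ~~ (A \subset N) ->
  exists2 M, sqf_factor H N M & M \subset N <*> A.
Proof.
move=> goodG nsKG sHG nsAH nsNH sAKN not_sAN.
pose P (L : {group gT}) := [&& L <| G, K \subset L & A :&: L \subset N].
have [|L maxL _] := @maxgroup_exists _ P K; first by rewrite /P nsKG subxx.
have [/and3P[nsLG sKL sALN] {}maxL] := maxgroupP maxL.
have sAG := subset_trans (normal_sub nsAH) sHG.
have [|M0 [[_ nsM0G sLM0 prM0]]] := goodG L nsLG sKL.
  apply: contra not_sAN => sGL.
  by rewrite -(setIidPl (subset_trans sAG sGL)).
case=> C [nsCG sMCL sqC].
have [sLG nLG] := andP nsLG; have [sM0G nM0G] := andP nsM0G.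
have [sNH nNH] := andP nsNH; have [sAH nAH] := andP nsAH.
have [sCG nCG] := andP nsCG.
have not_sBN : ~~ (A :&: M0 \subset N).
  apply: contraL prM0 => sBN; rewrite (maxL M0) ?indexgg //.
  by rewrite /P nsM0G (subset_trans sKL).
have sBH : A :&: M0 \subset H by rewrite subIset ?sAH.
have nNB := subset_trans sBH nNH.
have nLB : A :&: M0 \subset 'N(L) := subset_trans sBH (subset_trans sHG nLG).
exists (N <*> (A :&: M0))%G; last first.
  by rewrite join_subG joing_subl (subset_trans _ (joing_subr _ _)) ?subsetIl.
split.
- split=> //=; last 1 first.
  + have := prM0; rewrite -!card_quotient ?join_subG ?normG //; last first.
      exact: subset_trans sM0G nLG.
    rewrite quotientYidl // => /primeP[_ pr_dv].
    (* As [A :&: L] lies in [N], the order of [(A :&: M0) / N] divides that of [(A :&: M0) / L], a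
       subgroup of [M0 / L]. *)
    have /pr_dv/orP[|/eqP->] : #|(A :&: M0) / N| %| #|M0 / L|.
    * apply: (@dvdn_trans #|(A :&: M0) / L|); last first.
        by rewrite cardSg ?quotientS ?subsetIr.
      rewrite !card_quotient // -indexgI -(indexgI _ L) indexgS //.
      by rewrite subsetI subsetIl (subset_trans (setSI _ (subsetIl _ _))).
    * by rewrite -trivg_card1 -subG1 quotient_sub1 // (negPf not_sBN).
    * by rewrite card_quotient ?(subset_trans sM0G).
  + rewrite normalY // /normal sBH normsI //.
    exact: subset_trans sHG nM0G.
  + exact: joing_subl.
- exists (C :&: H)%G; split.
  + by rewrite /normal subsetIr normsI ?normG ?(subset_trans sHG).
  + have nNC : C :&: H \subset 'N(N) by rewrite subIset ?nNH ?orbT.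
    rewrite -quotient_cents2 ?join_subG ?normG // quotientYidl //.
    apply: quotient_cents2r.
    apply: subset_trans sALN; rewrite subsetI.
    rewrite (subset_trans _ sMCL) ?commgSS ?subsetIr ?subsetIl // andbT.
    rewrite (subset_trans (commgSS (subsetIl _ _) (subsetIr _ _))) //.
    by rewrite commg_subl.
  + apply: squarefree_dvd sqC; rewrite /= setIC indexgI.
    have nCH := subset_trans sHG nCG.
    by rewrite -!card_quotient // cardSg ?quotientS.
Qed.

Lemma sqf_aboveS (gT : finGroupType) (G H : {group gT}) :
  H \subset G -> sqf_above G 1 -> sqf_above H 1.
Proof.
move=> sHG goodG N nsNH _ not_sHN.
have [||M sqM _] := sqf_factorI goodG (normal1 G) sHG (normal_refl H) nsNH.
- by rewrite (setIidPr (sub1G _)) sub1G.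
- by [].
- by exists M.
Qed.

(** Above an [N] containing [A] the hypothesis on [A] applies. Otherwise the factors above [B] are
    cut down to [A], which is allowed because [A :&: B] lies in [N]. *)
Lemma sqf_above_setI (gT : finGroupType) (G A B : {group gT}) :
  A <| G -> B <| G -> sqf_above G A -> sqf_above G B -> sqf_above G (A :&: B).
Proof.
move=> nsAG nsBG goodA goodB N nsNG sABN not_sGN.
have [sAN | not_sAN] := boolP (A \subset N); first exact: goodA.
have [//|M sqM _] := sqf_factorI goodB nsBG (subxx G) nsAG nsNG sABN.
by exists M.
Qed.

(** * Transport of the factor criterion along morphisms and quotients *)

Lemma sqf_factor_morphim (aT rT : finGroupType) (D : {group aT})
    (f : {morphism D >-> rT}) (G N M : {group aT}) :
    G \subset D -> 'ker_G f \subset N -> sqf_factor G N M ->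
  sqf_factor (f @* G)%G (f @* N)%G (f @* M)%G.
Proof.
move=> sGD skN [[nsNG nsMG sNM prM] [C [nsCG sMCN sqC]]].
have sMG := normal_sub nsMG; have sCG := normal_sub nsCG.
have sMD := subset_trans sMG sGD; have sCD := subset_trans sCG sGD.
split.
  split; rewrite ?morphim_normal ?morphimS //=.
  suff /eqP kerM : #|'ker_M f : N| == 1%N.
    by have := index_morphim_ker f sNM sMD; rewrite kerM muln1 => ->.
  by rewrite indexg_eq1 (subset_trans (setSI _ sMG)).
exists (f @* C)%G; split; rewrite ?morphim_normal //.
  by rewrite -morphimR // morphimS.
by apply: squarefree_dvd sqC; rewrite index_morphim // subIset ?sGD.
Qed.

Lemma sqf_factor_morphpre (aT rT : finGroupType) (D : {group aT})
    (f : {morphism D >-> rT}) (G N M : {group rT}) :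
    G \subset f @* D -> sqf_factor G N M ->
  sqf_factor (f @*^-1 G)%G (f @*^-1 N)%G (f @*^-1 M)%G.
Proof.
move=> sGD [[nsNG nsMG sNM prM] [C [nsCG sMCN sqC]]].
have sMD := subset_trans (normal_sub nsMG) sGD.
have sCD := subset_trans (normal_sub nsCG) sGD.
have sND := subset_trans (normal_sub nsNG) sGD.
split; first by split; rewrite ?morphpre_normal ?morphpreS ?index_morphpre.
exists (f @*^-1 C)%G; split; rewrite ?morphpre_normal ?index_morphpre //.
rewrite -sub_morphim_pre ?comm_subG ?subsetIl //.
by rewrite morphimR ?subsetIl // !morphpreK.
Qed.

Lemma sqf_above_morphim (aT rT : finGroupType) (D : {group aT})
    (f : {morphism D >-> rT}) (G K : {group aT}) :
    G \subset D -> K \subset G -> sqf_above G K ->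
  sqf_above (f @* G) (f @* K).
Proof.
move=> sGD sKG goodG N nsNfG sfKN not_sGN.
have sNfG := normal_sub nsNfG; have sKD := subset_trans sKG sGD.
pose L := (G :&: f @*^-1 N)%G.
have imL : (f @* L)%G = N.
  by apply: val_inj; rewrite /= morphim_setIpre (setIidPr sNfG).
have [|||M sqM] := goodG L.
- rewrite /normal subsetIl normsI ?normG // -(setIidPr sGD).
  apply: subset_trans (morphpre_norm f N).
  by rewrite (setIidPr sGD) -sub_morphim_pre // normal_norm.
- by rewrite subsetI sKG -sub_morphim_pre.
- by apply: contra not_sGN => /(morphimS f); rewrite -imL.
- exists (f @* M)%G; rewrite -imL; apply: sqf_factor_morphim sGD _ sqM.
  by rewrite setIS ?ker_sub_pre.
Qed.

Lemma sqf_above_quotient_inv (gT : finGroupType) (N K G : {group gT}) :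
    N <| G -> N \subset K -> sqf_above (G / N) (K / N) -> sqf_above G K.
Proof.
move=> nsNG sNK goodGN L nsLG sKL not_sGL.
have sNL := subset_trans sNK sKL.
have sLG := normal_sub nsLG; have nNG := normal_norm nsNG.
have nsNL := normalS sNL sLG nsNG.
have [|||M sqM] := goodGN (L / N)%G.
- exact: quotient_normal.
- exact: quotientS.
- by rewrite quotientSGK.
- exists (coset N @*^-1 M)%G; have := sqf_factor_morphpre (sub_im_coset _) sqM.
  have -> : (coset N @*^-1 (L / N))%G = L by apply: val_inj; apply: quotientGK.
  have -> : (coset N @*^-1 (G / N))%G = G; last by [].
  by apply: val_inj; apply: quotientGK.
Qed.

(** * Equivalence of strong supersolubility with the factor criterion *)

Lemma supersoluble_quotient_prime (gT : finGroupType) (G N : {group gT}) :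
    supersoluble G -> N <| G -> ~~ (G \subset N) ->
  exists2 M : {group coset_of N}, M <| (G / N)%G & prime #|M|.
Proof.
case=> s s_path lastG nsNG not_sGN.
have s1N : 1%G \subset N := sub1G N.
elim: s 1%G s1N s_path lastG => [|K s IHs] H sHN /=.
  by move=> _ eqHG; rewrite -eqHG sHN in not_sGN.
case/andP=> /and4P[sHK nsHG nsKG cycKH] sK lastG.
(* At the first term [K] not inside [N], the previous term [H] is inside [N], so [K / N] is a
   quotient of the cyclic [K / H]. Its subgroup of prime order is characteristic in it, hence normal
   in [G / N]. *)
have [sKN | not_sKN] := boolP (K \subset N); first exact: (IHs K).
have [sKG nKG] := andP nsKG; have [sNG nNG] := andP nsNG.
have nNK := subset_trans sKG nNG.
have nHK := subset_trans sKG (normal_norm nsHG).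
have cycKN : cyclic (K / N).
  rewrite -(isog_cyclic (second_isog nNK)) /=.
  have nKNI : K \subset 'N(N :&: K) by rewrite normsI ?normG.
  have sHNK : H \subset N :&: K by rewrite subsetI sHN.
  have /homgP[f <-] := homg_quotientS nHK nKNI sHNK.
  exact: morphim_cyclic.
have ntKN : 1 < #|K / N| by rewrite cardG_gt1 -subG1 quotient_sub1.
have [x Kx ox] := Cauchy (pdiv_prime ntKN) (pdiv_dvd _).
exists <[x]>%G.
  apply: char_normal_trans (quotient_normal N nsKG).
  by rewrite sub_cyclic_char // cycle_subG.
by rewrite -orderE ox pdiv_prime.
Qed.

Lemma quotient_Sylow_lift (gT : finGroupType) (p : nat) (G N : {group gT})
    (P : {group coset_of N}) :
    N <| G -> p.-Sylow(G / N) P ->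
  exists2 Q : {group gT}, p.-Sylow(G) Q & P = (Q / N)%G.
Proof.
move=> nsNG sylP; have [Q sylQ] := Sylow_exists p G.
have nNG := normal_norm nsNG; have [sQG _ _] := and3P sylQ.
have sylQN := quotient_pHall (subset_trans sQG nNG) sylQ.
have [xb /morphimP[x Nx Gx ->] defP] := Sylow_trans sylQN sylP.
exists (Q :^ x)%G; first by rewrite pHallJ.
by apply: val_inj; rewrite /= quotientJ.
Qed.

Lemma strongly_supersoluble_sqf_above (gT : finGroupType) (G : {group gT}) :
  strongly_supersoluble G -> sqf_above G 1.
Proof.
case=> supG sylG N nsNG _ not_sGN; have nNG := normal_norm nsNG.
have [M nsM prM] := supersoluble_quotient_prime supG nsNG not_sGN.
have sqM : squarefree #|(G / N)%G : 'C_(G / N)(M)|.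
  apply: squarefree_automizer nsM prM _ => q P q_pr sylP.
  have [Q sylQ ->] := quotient_Sylow_lift nsNG sylP.
  exact: submodular_morphim nNG (sylG q Q q_pr sylQ).
have sqfM : sqf_factor (G / N)%G 1%G M.
  split; first by split; rewrite ?normal1 ?sub1G ?indexg1.
  exists 'C_(G / N)(M)%G; split=> //.
    by rewrite /normal subsetIl normsI ?normG ?norms_cent ?normal_norm.
  by rewrite subG1; apply/eqP/commG1P; rewrite centsC subsetIr.
exists (coset N @*^-1 M)%G; have := sqf_factor_morphpre (sub_im_coset _) sqfM.
have -> : (coset N @*^-1 1)%G = N by apply: val_inj; apply: cosetpre1.
by have -> : (coset N @*^-1 (G / N))%G = G by apply: val_inj; apply: quotientGK.
Qed.

Lemma sqf_above_supersoluble (gT : finGroupType) (G : {group gT}) :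
  sqf_above G 1 -> supersoluble G.
Proof.
move=> goodG; suff series n (N : {group gT}) : N <| G -> #|G : N| < n ->
    exists2 s : seq {group gT},
      path [rel H K : {group gT} |
            [&& H \subset K, H <| G, K <| G & cyclic (K / H)]] N s
      & last N s = G.
  exact: (series _ _ (normal1 G) (ltnSn _)).
elim: n N => // n IHn N nsNG ltGNn.
have sNG := normal_sub nsNG.
have [sGN|not_sGN] := boolP (G \subset N).
  by exists [::] => //=; apply/val_inj/eqP; rewrite eqEsubset sNG.
have [M [[_ nsMG sNM prM] _]] := goodG N nsNG (sub1G _) not_sGN.
have sMG := normal_sub nsMG.
have [|s sM lastG] := IHn M nsMG.
  rewrite -ltnS (leq_trans _ ltGNn) // ltnS -(Lagrange_index sMG sNM).
  by rewrite -[X in X < _]muln1 ltn_pmul2l ?indexg_gt0 // prime_gt1.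
exists (M :: s) => //=; rewrite sNM nsNG nsMG sM andbT /=.
rewrite prime_cyclic // card_quotient //.
exact: subset_trans sMG (normal_norm nsNG).
Qed.

Lemma sqf_above_solvable (gT : finGroupType) (G : {group gT}) :
  sqf_above G 1 -> solvable G.
Proof.
move=> goodG; pose P (N : {group gT}) := (N <| G) && solvable N.
have [|N maxN _] := @maxgroup_exists _ P 1%G.
  by rewrite /P normal1 solvable1.
have [/andP[nsNG solN] {}maxN] := maxgroupP maxN.
have [sGN|not_sGN] := boolP (G \subset N); first exact: solvableS sGN solN.
have [M [[_ nsMG sNM prM] _]] := goodG N nsNG (sub1G _) not_sGN.
have nsNM := normalS sNM (normal_sub nsMG) nsNG.
suff solM : solvable M.
  by rewrite (maxN M) ?indexgg // /P nsMG in prM.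
rewrite (series_sol nsNM) solN abelian_sol // cyclic_abelian //.
by rewrite prime_cyclic // card_quotient // normal_norm.
Qed.

Lemma proper_dvdn_mul_primes p q d :
  prime p -> prime q -> d %| (p * q)%N -> d != (p * q)%N ->
  (d == 1%N) || prime d.
Proof.
move=> p_pr q_pr /dvdnP[e eq_pq] neq.
have e_gt1 : 1 < e.
  move: eq_pq neq; case: e => [|[|//]] eq_pq.
    have: 0 < (p * q)%N by rewrite muln_gt0 !prime_gt0.
    by rewrite eq_pq.
  by rewrite eq_pq mul1n eqxx.
have dv_prime s t : prime s -> prime t -> (s * t = e * d)%N ->
    s %| e -> (d == 1%N) || prime d.
  move=> s_pr t_pr eq_st /dvdnP[k def_e]; move: eq_st.
  rewrite def_e [(k * s)%N]mulnC -mulnA => /eqP.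
  rewrite eqn_pmul2l ?prime_gt0 // => /eqP def_t.
  have /primeP[_ /(_ d)] := t_pr; rewrite def_t dvdn_mull // => /(_ isT).
  by case/orP=> [-> // | /eqP->]; rewrite -def_t t_pr orbT.
have s_pr := pdiv_prime e_gt1; have s_dv := pdiv_dvd e.
have: pdiv e %| (p * q)%N by rewrite eq_pq dvdn_mulr.
rewrite Euclid_dvdM // !dvdn_prime2 // => /orP[] /eqP eq_s;
  rewrite eq_s in s_dv.
  exact: (dv_prime p q).
by apply: (dv_prime q p); rewrite // mulnC.
Qed.

(** The order of [G] is a product of two primes, so [M] is maximal and each proper subgroup is
    trivial or of prime order. Law one follows by cases on [M \subset Z] and [X \subset M]; in law
    two only [Z = M] and [Z = G] occur. *)
Lemma modular_prime_index (gT : finGroupType) (M G : {group gT}) :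
  M \subset G -> prime #|M| -> prime #|G : M| -> modular M G.
Proof.
move=> sMG prM prGM.
have maxM (H : {group gT}) : M \subset H -> H \subset G -> H = M \/ H = G.
  move=> sMH sHG; have/maximal_eqP[_] : maximal_eq M G.
    by rewrite /maximal_eq p_index_maximal ?orbT.
  by case/(_ H sMH sHG) => /val_inj; [left | right].
apply/modularP; split=> // [X Z sZG sXZ | Y Z sYG sZG sMZ].
- have sXG := subset_trans sXZ sZG.
  have [sMZ | not_sMZ] := boolP (M \subset Z).
    rewrite (setIidPl sMZ).
    by apply/esym/setIidPl; rewrite join_subG sXZ.
  have tiMZ : M :&: Z = 1.
    by rewrite setIC; case: (prime_subgroupVti Z prM) not_sMZ => [->|].
  rewrite tiMZ joingG1.
  have [sXM | not_sXM] := boolP (X \subset M).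
    have X1 : X :=: 1 by apply/trivgP; rewrite -tiMZ subsetI sXM.
    by rewrite X1 joing1G tiMZ.
  have [||eqM|eqG] := maxM (X <*> M)%G; rewrite ?joing_subr ?join_subG ?sXG //.
    by case/negP: not_sXM; rewrite -eqM joing_subl.
  have /= -> := congr1 (@gval gT) eqG; rewrite (setIidPr sZG).
  have prZ : (#|Z| == 1%N) || prime #|Z|.
    apply: (proper_dvdn_mul_primes prM prGM); rewrite Lagrange ?cardSg //.
    apply: contra not_sMZ => /eqP eqZG.
    have defZ : Z :=: G by apply/eqP; rewrite eqEcard sZG eqZG leqnn.
    by rewrite defZ.
  case/orP: prZ => [|prZ].
    rewrite -trivg_card1 => /eqP Z1; move: sXZ.
    by rewrite Z1 subG1 => /eqP.
  case: (prime_subgroupVti X prZ) => [sZX|].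
    by apply/eqP; rewrite eqEsubset sXZ.
  rewrite (setIidPl sXZ) => X1; case/negP: not_sXM.
  by rewrite X1 sub1G.
- have [->|->] := maxM Z sMZ sZG.
    rewrite (setIidPr (joing_subl _ _)).
    by apply/joing_idPl; apply: subsetIr.
  by rewrite (setIidPl sYG) (setIidPl _) // join_subG sMG.
Qed.

Lemma sqf_above_sub (gT : finGroupType) (G K L : {group gT}) :
  K \subset L -> sqf_above G K -> sqf_above G L.
Proof.
by move=> sKL goodG N nsNG sLN; apply: goodG; rewrite ?(subset_trans sKL).
Qed.

Lemma sqf_above_quotient (gT : finGroupType) (G N K : {group gT}) :
    N <| G -> K \subset G -> sqf_above G K ->
  sqf_above (G / N)%G (K / N)%G.
Proof. by move=> nsNG; apply: sqf_above_morphim; apply: normal_norm. Qed.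

Lemma sqf_above1_quotient (gT : finGroupType) (G N : {group gT}) :
  N <| G -> sqf_above G 1 -> sqf_above (G / N)%G 1.
Proof.
move=> nsNG /(sqf_above_quotient nsNG (sub1G G)); apply: sqf_above_sub.
by rewrite /= quotient1.
Qed.

(** Induction on the order, with [N] normal of prime order. As [N <*> Q] is submodular by induction
    in [G / N], one may assume [G = N <*> Q] and [N :&: Q = 1]. Then ['C_Q(N)] is normal in [G] and
    can be factored out; once it is trivial, [Q] is trivial or of order [q] with prime index. *)
Lemma sqf_above_submodular (gT : finGroupType) (G Q : {group gT}) q :
  sqf_above G 1 -> prime q -> q.-Sylow(G) Q -> submodular Q G.
Proof.
move=> goodG q_pr; have [n] := ubnP #|G|.
elim: n gT G Q goodG => // n IHn gT G Q goodG /ltnSE leGn sylQ.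
have [sQG qQ _] := and3P sylQ.
have lift (N : {group gT}) : N <| G -> N :!=: 1 -> submodular (N <*> Q)%G G.
  move=> nsNG ntN; have [sNG nNG] := andP nsNG.
  have nNQ := subset_trans sQG nNG.
  apply: (submodular_quotient_inv nsNG); rewrite ?joing_subl ?join_subG ?sNG //.
  have -> : ((N <*> Q) / N)%G = (Q / N)%G by apply/val_inj/quotientYidl.
  apply: IHn; first exact: sqf_above1_quotient.
    by rewrite (leq_trans _ leGn) // ltn_quotient.
  exact: quotient_pHall.
have [sG1|ntG] := boolP (G \subset 1%G).
  have -> : Q = G; last exact: submodular_refl.
  apply/val_inj/eqP; rewrite eqEsubset sQG (subset_trans sG1) ?sub1G //.
have [N [[_ nsNG _]]] := goodG _ (normal1 G) (subxx _) ntG.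
rewrite indexg1 => prN [C [nsCG cNC sqC]].
have [sNG nNG] := andP nsNG; have ntN : N :!=: 1.
  by rewrite -cardG_gt1 prime_gt1.
have subNQ := lift N nsNG ntN; have sNQG := submodular_sub subNQ.
have [properNQ | not_properNQ] := ltnP #|N <*> Q| #|G|.
  apply: submodular_trans subNQ; apply: IHn.
      exact: sqf_aboveS goodG.
    exact: leq_trans properNQ _.
  exact: pHall_subl (joing_subr _ _) sNQG sylQ.
have defG : N <*> Q = G by apply/eqP; rewrite eqEcard sNQG.
have [sNQ | not_sNQ] := boolP (N \subset Q).
  have -> : Q = G; last exact: submodular_refl.
  by apply: val_inj; rewrite /= -defG; apply/esym/joing_idPr.
have tiNQ : N :&: Q = 1.
  by rewrite setIC; case: (prime_subgroupVti Q prN) not_sNQ => [->|].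
have nsCQG : 'C_Q(N) <| G.
  rewrite /normal subIset ?sQG //= -defG join_subG.
  rewrite (subset_trans _ (cent_sub _)) /=; last by rewrite centsC subsetIr.
  by rewrite normsI ?normG ?norms_cent ?(subset_trans sQG).
have [C1 | ntC] := eqVneq 'C_Q(N) 1; last first.
  apply: (submodular_quotient_inv nsCQG (subsetIl _ _) sQG).
  apply: IHn; first exact: sqf_above1_quotient nsCQG goodG.
    by rewrite (leq_trans _ leGn) // ltn_quotient // subIset ?sQG.
  by apply: quotient_pHall sylQ; rewrite (subset_trans sQG) ?normal_norm.
(* [Q] acts faithfully on [N], so [#|Q|] divides the index of ['C_G(N)], which is squarefree because
   [C] centralizes [N]. *)
have dvQq : #|Q| %| q.
  apply: squarefree_pnat q_pr qQ _.
  have sCC : C \subset 'C_G(N).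
    by rewrite subsetI (normal_sub nsCG) centsC; apply/commG1P/trivgP.
  apply: squarefree_dvd (squarefree_dvd (indexgS G sCC) sqC).
  have nCG : G \subset 'N('C_G(N)) by rewrite normsI ?normG ?norms_cent.
  have -> : #|Q| = #|Q : 'C_G(N)|.
    by rewrite -indexgI /= setIA (setIidPl sQG) C1 indexg1.
  by rewrite -!card_quotient ?cardSg ?quotientS // (subset_trans sQG).
have [_ /(_ _ dvQq)/orP[|/eqP oQ]] := primeP q_pr.
  rewrite -trivg_card1 => /eqP Q1.
  have -> : Q = 1%G by apply: val_inj.
  exact/modular_submodular/modular1.
apply/modular_submodular/modular_prime_index; rewrite ?oQ //.
rewrite -divgS // -defG /= norm_joinEr ?(subset_trans sQG) //.
by rewrite TI_cardMg // mulnK.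
Qed.

Lemma strongly_supersolubleP (gT : finGroupType) (G : {group gT}) :
  strongly_supersoluble G <-> sqf_above G 1.
Proof.
split=> [|goodG]; first exact: strongly_supersoluble_sqf_above.
split=> [|q Q]; first exact: sqf_above_supersoluble.
exact: sqf_above_submodular.
Qed.

(** * Saturation *)

(** ['X^#|F| - 'X] is the product of all ['X - a] with [a] in [F], so the minimal polynomial of [A],
    a nonconstant divisor of it, has a root in [F]. *)
Lemma finField_eigenvalue_exists (F : finFieldType) n (A : 'M[F]_n.+1) :
  (A ^+ #|F| = A)%R -> exists a, eigenvalue A a.
Proof.
move=> AF; have /mxminpoly_min: horner_mx A ('X^#|F| - 'X)%R = 0%R.
  by rewrite rmorphB rmorphXn /= horner_mx_X AF subrr.
rewrite finField_genPoly => /dvdp_prod_XsubC[m]; case: (mask m _) => [|a s] eqp.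
  have /eqP := eqp_size eqp.
  rewrite size_mxminpoly big_nil size_poly1 eqSS -leqn0 leqNgt.
  by rewrite mxminpoly_nonconstant.
exists a; rewrite eigenvalue_root_min (eqp_root eqp) big_cons.
by rewrite rootM root_XsubC eqxx.
Qed.

(** Each [rG x] has an eigenvalue, and its eigenspace is a submodule because the operators commute;
    by irreducibility [rG x] is scalar. Every line is then a submodule, in particular the one
    spanned by [pid_mx 1]. *)
Lemma mx_irr_commuting_dim1 (F : finFieldType) (gT : finGroupType)
    (G : {group gT}) n (rG : mx_representation F G n.+1) q :
    #|F| = q -> mx_irreducible rG ->
    {in G &, forall x y, rG x *m rG y = rG y *m rG x}%R ->
    {in G, forall x, rG x ^+ q = rG x}%R ->
  n = 0%N.
Proof.
move=> <- [_ _ irrG] comG expG.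
have scalG x : x \in G -> exists a, rG x = (a%:M)%R.
  move=> Gx; have [a eig_a] := finField_eigenvalue_exists (expG x Gx).
  exists a; have: ((1%:M)%R <= eigenspace (rG x) a)%MS.
    apply: irrG; rewrite ?submx1 //; apply/mxmoduleP=> y Gy.
    apply/eigenspaceP; rewrite -mulmxA -comG // mulmxA.
    by rewrite (eigenspaceP (submx_refl _)) scalemxAl.
  by move/eigenspaceP; rewrite mul1mx scalemx1.
have: ((1%:M)%R <= (pid_mx 1 : 'M[F]_n.+1))%MS.
  apply: irrG; rewrite ?submx1 //; last by rewrite -mxrank_eq0 rank_pid_mx.
  apply/mxmoduleP=> x Gx; have [a ->] := scalG x Gx.
  by rewrite mul_mx_scalar scalemx_sub.
by move/mxrankS; rewrite mxrank1 rank_pid_mx // ltnS leqn0 => /eqP.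
Qed.

Lemma minnormal_exponent_pred (gT : finGroupType) (G M : {group gT}) p :
    minnormal M G -> p.-abelem M -> prime p ->
    G^`(1) \subset 'C(M) ->
    {in G, forall x, x ^+ p.-1 \in 'C(M)} ->
  prime #|M|.
Proof.
move=> minM abelM p_pr cGM expM; have /andP[ntM nMG] := mingroupp minM.
have [pM _ _] := and3P abelM.
pose rG := abelem_repr abelM ntM nMG.
have irrG : mx_irreducible rG by apply/abelem_mx_irrP.
have rG1 x : x \in G -> x \in 'C(M) -> rG x = (1%:M)%R.
  move=> Gx cMx; suff: x \in rker rG by rewrite inE Gx mul1mx => /eqP.
  by rewrite rker_abelem inE Gx.
(* The representation over ['F_p] has dimension [n.+1], and this predecessor is its [n]. Derived
   elements act trivially, so the operators commute; since [x ^+ p.-1] acts trivially,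
   [rG x ^+ p = rG x]. *)
have dim0: (logn (pdiv #|M|) #|M|).-1 = 0%N.
  apply: (mx_irr_commuting_dim1 (card_Fp p_pr) irrG) => [x y Gx Gy | x Gx].
    have Rxy : [~ x, y] \in G^`(1) by rewrite mem_commg.
    have GRxy := subsetP (der_sub 1 G) _ Rxy.
    rewrite -!repr_mxM // commgC [rG (y * x * _)]repr_mxM ?(groupM Gy Gx) //.
    by rewrite (rG1 _ GRxy (subsetP cGM _ Rxy)) mulmx1.
  rewrite -[X in (_ ^+ X)%R](prednK (prime_gt0 p_pr)).
  by rewrite exprSr -repr_mxX // rG1 ?expM ?groupX //; apply: mul1mx.
have := dim_abelemE abelM ntM; rewrite /abelem_dim' dim0 => logM.
by rewrite (card_pgroup pM) -logM.
Qed.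

(** * Automizers of factors and the exponent of the group modulo its [p]-core *)

Lemma squarefree_radical n : 0 < n ->
  exists e, [/\ e %| n, squarefree e &
    forall m, m %| n -> squarefree m -> m %| e].
Proof.
move=> n_gt0; pose sqf m := all (fun q => logn q m <= 1) (primes m).
have sqfP m : 0 < m -> reflect (squarefree m) (sqf m).
  move=> m_gt0; apply: (iffP allP) => [sq q q_pr | sq q].
    rewrite pfactor_dvdn // -ltnNge.
    have [/sq // | not_q] := boolP (q \in primes m).
    by move: not_q; rewrite -logn_gt0 -leqNgt; case: logn.
  rewrite mem_primes => /and3P[q_pr _ _]; have := sq q q_pr.
  by rewrite pfactor_dvdn // -ltnNge.
(* [e] is the least common multiple of the squarefree divisors of [n]. It stays squarefree because
   [logn] of an lcm is a maximum. *)
pose e := \big[lcmn/1%N]_(d < n.+1 | (d %| n) && sqf d) d.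
have e_dv : e %| n by apply/dvdn_biglcmP=> d /andP[].
exists e; split=> // [|m m_dv sq_m]; last first.
  have m_gt0 := dvdn_gt0 n_gt0 m_dv.
  have lt_m : m < n.+1 by rewrite ltnS dvdn_leq.
  by rewrite (@biglcmn_sup _ (Ordinal lt_m)) //= m_dv; apply/sqfP.
have [e_gt0 sq_e] : 0 < e /\ squarefree e; last by [].
rewrite /e.
elim/big_ind: _ => [|a b [a_gt0 sq_a] [b_gt0 sq_b]|d /andP[d_dv sq_d]].
- by split=> // q q_pr; rewrite gtnNdvd // -(exp1n 2) ltn_exp2r // prime_gt1.
- split=> [|q q_pr]; first by rewrite lcmn_gt0 a_gt0.
  have := sq_a q q_pr; have := sq_b q q_pr.
  rewrite !pfactor_dvdn ?lcmn_gt0 ?a_gt0 // logn_lcm // -!ltnNge => ltb lta.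
  by rewrite gtn_max lta.
- by have d_gt0 := dvdn_gt0 n_gt0 d_dv; split=> //; apply/sqfP.
Qed.

(** [K] is the full centralizer of [M / N] in [G]. As [M / N] has prime order, [G / K] embeds in a
    cyclic group of order [#|M : N|.-1]; its order is squarefree because [K] contains the given
    [C]. *)
Lemma sqf_factor_automizer (gT : finGroupType) (G N M : {group gT}) :
    sqf_factor G N M ->
  exists K : {group gT}, [/\ K <| G, [~: M, K] \subset N, cyclic (G / K),
    #|G : K| %| #|M : N|.-1 & squarefree #|G : K|].
Proof.
case=> -[nsNG nsMG sNM prM] [C [nsCG sMCN sqC]].
have [sNG nNG] := andP nsNG; have [sMG nMG] := andP nsMG.
have [sCG nCG] := andP nsCG.
have nNM := subset_trans sMG nNG; have nNC := subset_trans sCG nNG.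
have prMN : prime #|M / N| by rewrite card_quotient.
have nMGN : G / N \subset 'N(M / N) by rewrite quotient_norms.
have nsKb : 'C_(G / N)(M / N) <| G / N.
  by rewrite /normal subsetIl normsI ?normG ?norms_cent.
have defG : coset N @*^-1 (G / N) = G by apply: quotientGK.
pose K := (coset N @*^-1 'C_(G / N)(M / N))%G.
have iK : #|G : K| = #|G / N : 'C_(G / N)(M / N)|.
  by rewrite -{1}defG index_cosetpre.
have nsKG : K <| G by rewrite -defG cosetpre_normal.
have sNK : N \subset K by rewrite /= -{1}(ker_coset N) ker_sub_pre.
have KN : K / N = 'C_(G / N)(M / N) by apply: cosetpreK.
exists K; split=> //.
- rewrite -quotient_cents2 ?subsetIl // KN centsC subsetIr //.
- have [f injf imf] := third_isom sNK nsNG nsKG.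
  rewrite -imf // morphim_cyclic //.
  by rewrite KN automizer_prime_cyclic.
- by rewrite iK -[#|M : N|]card_quotient // automizer_prime_dvd.
- rewrite iK; apply: squarefree_dvd (squarefree_dvd (index_quotient _) sqC).
    apply: indexgS; rewrite subsetI quotientS //=.
    by rewrite centsC quotient_cents2r.
  by rewrite subIset ?nNG.
Qed.

(** By coprime action the fixed points of [S] on [M / N] lift to [M], so ['C_M(S)] covers [M / N];
    it also contains [N]. *)
Lemma coprime_cent_factor (gT : finGroupType) (S M N : {group gT}) :
    N <| M -> S \subset 'N(M) -> S \subset 'N(N) -> coprime #|N| #|S| ->
    solvable N -> [~: M, S] \subset N -> S \subset 'C(N) -> S \subset 'C(M).
Proof.
move=> nsNM nMS nNS coNS solN sMSN cNS; have [sNM nNM] := andP nsNM.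
have sub : M / N \subset 'C_M(S) / N.
  rewrite coprime_norm_quotient_cent // subsetI subxx /=.
  exact: quotient_cents2r.
have := sub; rewrite quotientSGK // => [|]; last by rewrite subsetI sNM centsC.
by rewrite subsetI subxx centsC.
Qed.

(** Let [N] be the center of ['F(G)]. If the inclusion failed, there would be a normal [M] above [N]
    in ['C_G('F(G))] with [M / N] of prime order. [N] is central in [M], so [M] is abelian, hence
    inside ['F(G)] and equal to [N]. *)
Lemma sqf_above_cent_Fitting (gT : finGroupType) (G : {group gT}) :
  sqf_above G 1 -> 'C_G('F(G)) \subset 'F(G).
Proof.
move=> goodG; apply/idPn=> not_sCF.
have nsFG := Fitting_normal G.
have nsCG : 'C_G('F(G)) <| G.
  by rewrite /normal subsetIl normsI ?normG ?norms_cent ?normal_norm.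
pose N := ('F(G) :&: 'C_G('F(G)))%G.
have nsNG : N <| G by apply: normalI.
have [||M [[_ nsMG sNM prM] _]] :=
    sqf_factorI goodG (normal1 G) (subxx G) nsCG nsNG.
    by rewrite setIC subIset ?sub1G.
  by apply: contra not_sCF => /subset_trans-> //; apply: subsetIl.
rewrite (joing_idPr (subsetIr _ _)) => sMC.
have nsNM := normalS sNM (normal_sub nsMG) nsNG.
have abM : abelian M.
  apply: (@cyclic_factor_abelian _ N).
    rewrite subsetI sNM centsC (subset_trans sMC) //.
    by rewrite (subset_trans (subsetIr _ _)) ?centS ?subsetIl.
  by rewrite prime_cyclic // card_quotient // normal_norm.
have sMN : M \subset N by rewrite subsetI sMC Fitting_max // abelian_nil.
by move: prM; rewrite (eqP (_ : #|M : N| == 1%N)) // indexg_eq1.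
Qed.

(* A subgroup of order q != p of D centralizes every G-invariant factor inside
   ['O_p(G) = 'F(G)], hence by coprime action the self-centralizing subgroup
   'F(G) itself. *)
Lemma sub_pcore_sqf_above (gT : finGroupType) (p : nat) (G D : {group gT}) :
    sqf_above G 1 -> 'O_p^'(G) = 1 -> D <| G ->
    (forall N M : {group gT}, sqf_factor G N M -> #|M : N| = p ->
       [~: M, D] \subset N) ->
  D \subset 'O_p(G).
Proof.
move=> goodG Op'1 nsDG cenD; have solG := sqf_above_solvable goodG.
have nsFG : 'O_p(G) <| G := pcore_normal p G.
have sCFF : 'C_G('O_p(G)) \subset 'O_p(G).
  by rewrite -(Fitting_eq_pcore Op'1) sqf_above_cent_Fitting.
apply: (pcore_max _ nsDG); apply/pgroupP=> q q_pr q_dv; apply/idPn=> p'q.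
have [x Dx ox] := Cauchy q_pr q_dv.
have Gx := subsetP (normal_sub nsDG) x Dx.
have sSG : <[x]> \subset G by rewrite cycle_subG.
have coS (N : {group gT}) : N \subset 'O_p(G) -> coprime #|N| #|<[x]>|.
  move=> sNF; apply: (@pnat_coprime p).
    exact: pgroupS sNF (pcore_pgroup _ _).
  by rewrite -orderE ox pnatE.
pose P (N : {group gT}) := [&& N <| G, N \subset 'O_p(G) & <[x]> \subset 'C(N)].
have [|N maxN _] := @maxgroup_exists _ P 1%G.
  by rewrite /P normal1 sub1G cents1.
have [/and3P[nsNG sNF cNS] {}maxN] := maxgroupP maxN.
have cFS : <[x]> \subset 'C('O_p(G)).
  have [sFN | not_sFN] := boolP ('O_p(G) \subset N).
    exact: subset_trans cNS (centS sFN).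
  have [|M sqM] := sqf_factorI goodG (normal1 G) (subxx G) nsFG nsNG _ not_sFN.
    by rewrite setIC subIset ?sub1G.
  rewrite (joing_idPr sNF) => sMF.
  have [[_ nsMG sNM prM] _] := sqM.
  have pM : p.-group M := pgroupS sMF (pcore_pgroup _ _).
  have oM : #|M : N| = p.
    by have := pnat_dvd (dvdn_indexg M N) pM; rewrite pnatE // inE => /eqP.
  have nsNM := normalS sNM (normal_sub nsMG) nsNG.
  have cMS : <[x]> \subset 'C(M).
    have nMS := subset_trans sSG (normal_norm nsMG).
    have nNS := subset_trans sSG (normal_norm nsNG).
    have solN := solvableS (normal_sub nsNG) solG.
    apply: (coprime_cent_factor nsNM nMS nNS (coS N sNF) solN) => //.
    by apply: subset_trans (cenD N M sqM oM); rewrite commgS ?cycle_subG.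
  by rewrite (maxN M) ?indexgg // /P nsMG sMF in prM.
have: <[x]> \subset 'O_p(G).
  by apply: subset_trans sCFF; rewrite subsetI sSG.
move/(pgroupS)/(_ (pcore_pgroup _ _)); rewrite /pgroup -orderE ox pnatE //.
by apply/negP.
Qed.

Lemma sqf_above_pcore_exponent (gT : finGroupType) (p : nat) (G : {group gT}) :
    sqf_above G 1 -> prime p -> 'O_p^'(G) = 1 ->
  exists e, [/\ e %| p.-1, squarefree e, G^`(1) \subset 'O_p(G)
    & {in G, forall x, x ^+ e \in 'O_p(G)}].
Proof.
move=> goodG p_pr Op'1.
have [|e [e_dv sq_e e_max]] := @squarefree_radical p.-1.
  by rewrite -subn1 subn_gt0 prime_gt1.
pose D := <<G^`(1) :|: [set x ^+ e | x in G]>>%G.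
have sG'D : G^`(1) \subset D by rewrite sub_gen ?subsetUl.
have XeD x : x \in G -> x ^+ e \in D.
  by move=> Gx; apply/mem_gen/setUP; right; apply/imsetP; exists x.
have sDG : D \subset G.
  rewrite gen_subG subUset der_sub; apply/subsetP=> _ /imsetP[x Gx ->].
  exact: groupX.
suff sDF : D \subset 'O_p(G).
  exists e; split=> // [|x /XeD]; first exact: subset_trans sDF.
  exact: subsetP.
apply: sub_pcore_sqf_above => // [|N M sqM oM].
  exact: sub_der1_normal.
have [K [nsKG sMKN cycK dvK sqK]] := sqf_factor_automizer sqM.
have nKG := normal_norm nsKG.
apply: subset_trans sMKN; rewrite commgS // gen_subG subUset.
rewrite der1_min ?cyclic_abelian //; apply/subsetP=> _ /imsetP[x Gx ->].
have Nx := subsetP nKG x Gx.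
apply: coset_idr; first by rewrite groupX.
have /dvdnP[k ->] : #|G : K| %| e by rewrite e_max // -oM.
rewrite mulnC expgM -card_quotient // morphX ?groupX // morphX //.
by rewrite expg_cardG ?expg1n // mem_quotient.
Qed.

(** * Frattini arguments and the lift from [G / 'Phi(G)] to [G] *)

Lemma Sylow_Phi_normal (gT : finGroupType) (p : nat) (G P : {group gT}) :
  p.-Sylow('Phi(G)) P -> P <| G.
Proof.
move=> sylP; have sPG := subset_trans (pHall_sub sylP) (Phi_sub G).
have genN : 'Phi(G) <*> 'N_G(P) = G.
  have := Frattini_arg (Phi_normal G) sylP; rewrite -norm_joinEr //.
  exact: subset_trans (subsetIl _ _) (normal_norm (Phi_normal G)).
have := Phi_nongen genN; rewrite genGid => <-.
by rewrite normal_subnorm.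
Qed.

(** Let [K] be the preimage of the [p']-core and [Q] a Hall [p']-subgroup of [K]. [Q] covers
    [K / 'Phi(G)], so the Frattini argument gives [G = 'Phi(G) <*> 'N_G(Q)]. Since ['Phi(G)]
    consists of nongenerators, [Q] is normal in [G], hence trivial. *)
Lemma pcore_quotient_Phi (gT : finGroupType) (p : nat) (G : {group gT}) :
    solvable G -> p.-group 'Phi(G) -> 'O_p^'(G) = 1 ->
  'O_p^'(G / 'Phi(G)) = 1.
Proof.
move=> solG pPhi Op'1; have nsPG := Phi_normal G; have [sPG nPG] := andP nsPG.
pose K := (coset 'Phi(G) @*^-1 'O_p^'(G / 'Phi(G)))%G.
have defG : coset 'Phi(G) @*^-1 (G / 'Phi(G)) = G by apply: quotientGK.
have nsKG : K <| G by rewrite -[X in _ <| X]defG cosetpre_normal pcore_normal.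
have KP : K / 'Phi(G) = 'O_p^'(G / 'Phi(G)) by apply: cosetpreK.
have solK := solvableS (normal_sub nsKG) solG.
have [Q hallQ] := Hall_exists p^' solK.
have sQK := pHall_sub hallQ; have sQG := subset_trans sQK (normal_sub nsKG).
have nPQ := subset_trans sQG nPG.
have QP : Q / 'Phi(G) = K / 'Phi(G).
  have p'KP : p^'.-group (K / 'Phi(G)) by rewrite KP pcore_pgroup.
  exact: pHall_id (quotient_pHall nPQ hallQ) p'KP.
have genN : 'Phi(G) <*> 'N_G(Q) = G.
  apply/eqP; rewrite eqEsubset join_subG sPG subsetIl /=.
  rewrite -{1}(Hall_Frattini_arg solK nsKG hallQ) mul_subG ?joing_subr //.
  have nPN : 'N_G(Q) \subset 'N('Phi(G)).
    by rewrite (subset_trans (subsetIl _ _)).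
  rewrite /= norm_joinEr // -quotientSK ?subsetIl // -QP quotientS //.
  by rewrite subsetI sQG normG.
have nQG : G \subset 'N(Q).
  by have := Phi_nongen genN; rewrite genGid => <-; apply: subsetIr.
have Q1 : Q :=: 1.
  apply/trivgP; rewrite -Op'1 pcore_max ?(pHall_pgroup hallQ) //.
  exact/andP.
by rewrite -KP -QP Q1 quotient1.
Qed.

Lemma sqf_above_minnormal (gT : finGroupType) (p : nat) (G M : {group gT}) :
    sqf_above (G / 'Phi(G))%G 1 -> prime p -> p.-group 'Phi(G) ->
    'O_p^'(G) = 1 -> minnormal M G -> p.-group M -> M \subset G ->
  sqf_factor G 1 M.
Proof.
move=> goodG p_pr pPhi Op'1 minM pM sMG.
have nsPG := Phi_normal G; have [sPG nPG] := andP nsPG.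
have solG : solvable G.
  by rewrite (series_sol nsPG) (pgroup_sol pPhi) sqf_above_solvable.
have [e [e_dv sq_e sG'O XeO]] :=
  sqf_above_pcore_exponent goodG p_pr (pcore_quotient_Phi solG pPhi Op'1).
rewrite /= pquotient_pcore // in sG'O XeO.
have sPO : 'Phi(G) \subset 'O_p(G) by apply: pcore_max.
have sG'F : G^`(1) \subset 'O_p(G).
  rewrite -quotient_der // quotientSGK // in sG'O.
  by apply: subset_trans (der_sub 1 G) nPG.
have XeF x : x \in G -> x ^+ e \in 'O_p(G).
  move=> Gx; have Nx := subsetP nPG x Gx.
  have := XeO _ (mem_quotient 'Phi(G) Gx); rewrite -morphX //.
  rewrite -!sub1set -quotient_set1 ?groupX // quotientSGK //.
  by rewrite sub1set groupX.
have [ntM nMG] := andP (mingroupp minM).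
have nsMG : M <| G by apply/andP.
have sMF : M \subset 'O_p(G) by apply: pcore_max.
have nsFG := pcore_normal p G.
(* The normal subgroup [M] meets the center of the nilpotent group ['O_p(G)] nontrivially, so by
   minimality it lies in that center. *)
have cMF : 'O_p(G) \subset 'C(M).
  have ntMZ := meet_center_nil (pgroup_nil (pcore_pgroup p G))
    (normalS sMF (normal_sub nsFG) nsMG) ntM.
  have nMZG : G \subset 'N(M :&: 'Z('O_p(G))).
    by rewrite normsI // normal_norm // (char_normal_trans (center_char _)).
  have [_ minM'] := mingroupP minM.
  have /minM' eqM :
    ((M :&: 'Z('O_p(G)))%G :!=: 1) && (G \subset 'N(M :&: 'Z('O_p(G)))).
    by rewrite ntMZ.
  rewrite centsC -(eqM (subsetIl _ _)) /= subIset // orbC.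
  by rewrite subsetIr.
have [_ _ abelM] := minnormal_solvable minM sMG solG.
have {}abelM : p.-abelem M.
  have [_ _ [k oM]] := pgroup_pdiv pM ntM.
  by move: abelM; rewrite /is_abelem oM pdiv_pfactor.
have prM : prime #|M|.
  apply: (minnormal_exponent_pred minM abelM p_pr).
    exact: subset_trans sG'F cMF.
  move=> x Gx; have /dvdnP[k ->] := e_dv.
  by rewrite mulnC expgM groupX // (subsetP cMF) ?XeF.
split; first by rewrite normal1 sub1G indexg1.
exists 'C_G(M)%G; have nCG : G \subset 'N('C_G(M)).
  by rewrite normsI ?normG ?norms_cent.
split; first by rewrite /normal subsetIl.
  by rewrite subG1; apply/eqP/commG1P; rewrite centsC subsetIr.
(* The automizer is cyclic and its generator is killed by the power [e], so its order divides
   [e]. *)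
apply: squarefree_dvd sq_e; rewrite -card_quotient //.
have /cyclicP[xb defC] := automizer_prime_cyclic nMG prM.
rewrite defC -orderE order_dvdn.
have : xb \in G / 'C_G(M) by rewrite defC cycle_id.
case/morphimP=> x Nx Gx ->; rewrite -morphX //= coset_id //.
by rewrite inE groupX // (subsetP cMF) ?XeF.
Qed.

(** Induction on the order. ['Phi(G)] maps into the Frattini subgroup of each quotient, so the
    criterion holds above every nontrivial normal subgroup, and two of these with trivial
    intersection finish the proof. Comparison with a Sylow [p]-subgroup [P] of ['Phi(G)], normal in
    [G], leaves the case of a trivial [p']-core, a [p]-group ['Phi(G)] and a minimal normal subgroup
    inside [P]. *)
Lemma sqf_above_Phi (gT : finGroupType) (G : {group gT}) :
  sqf_above G 'Phi(G) -> sqf_above G 1.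
Proof.
have [n] := ubnP #|G|; elim: n gT G => // n IHn gT G /ltnSE leGn goodG.
have nsPG := Phi_normal G; have nPG := normal_norm nsPG.
have quo_good (N : {group gT}) : N <| G -> N :!=: 1 -> sqf_above G N.
  move=> nsNG ntN; apply: (sqf_above_quotient_inv nsNG (subxx N)).
  have ltGN : #|G / N| < n.
    by rewrite (leq_trans _ leGn) // ltn_quotient // normal_sub.
  have goodGN : sqf_above (G / N)%G 1.
    apply: IHn ltGN _.
    apply: sqf_above_sub (sqf_above_quotient nsNG (Phi_sub G) goodG).
    exact: morphimF (normal_norm nsNG).
  by apply: sqf_above_sub goodGN; apply: sub1G.
have TIgood (A B : {group gT}) :
    A <| G -> B <| G -> A :!=: 1 -> B :!=: 1 -> A :&: B = 1 -> sqf_above G 1.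
  move=> nsAG nsBG ntA ntB tiAB.
  have <- : (A :&: B)%G = 1%G by apply: val_inj.
  by apply: sqf_above_setI => //; apply: quo_good.
have [Phi1 | ntPhi] := eqVneq 'Phi(G) 1.
  by apply: sqf_above_sub goodG; rewrite /= Phi1.
pose p := pdiv #|'Phi(G)|.
have p_pr : prime p by rewrite pdiv_prime ?cardG_gt1.
have [P sylP] := Sylow_exists p 'Phi(G).
have nsP := Sylow_Phi_normal sylP.
have ntP : P :!=: 1.
  by rewrite -rank_gt0 (rank_Sylow sylP) p_rank_gt0 pi_pdiv cardG_gt1.
have pP := pHall_pgroup sylP.
have TIP (A : {group gT}) : A <| G -> p^'.-group A -> A :!=: 1 -> sqf_above G 1.
  move=> nsA p'A ntA; apply: (TIgood P A) => //.
  exact/coprime_TIg/(pnat_coprime pP p'A).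
have [Op'1 | ntOp'] := eqVneq 'O_p^'(G) 1; last first.
  exact: (TIP _ (pcore_normal _ _) (pcore_pgroup _ _)).
have [pPhi | p'Phi] := boolP (p.-group 'Phi(G)); last first.
  move: p'Phi; rewrite /pgroup /pnat cardG_gt0 => /allPn[q].
  rewrite mem_primes cardG_gt0 /= => /andP[q_pr q_dv] p'q.
  have [Q sylQ] := Sylow_exists q 'Phi(G).
  apply: (TIP Q (Sylow_Phi_normal sylQ)) => //.
    by apply: sub_in_pnat (pHall_pgroup sylQ) => r _ /eqP->.
  by rewrite -rank_gt0 (rank_Sylow sylQ) p_rank_gt0 mem_primes q_pr cardG_gt0.
have ntG : G :!=: 1.
  by apply: contra ntPhi; rewrite -!subG1 => /(subset_trans (Phi_sub G)).
have [M minM sMG] := minnormal_exists ntG (normG G).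
have [ntM nMG] := andP (mingroupp minM).
have nsMG : M <| G by apply/andP.
have [tiPM | ntPM] := eqVneq (P :&: M) 1.
  exact: (TIgood P M).
have pM : p.-group M.
  have [_ minM'] := mingroupP minM.
  apply: pgroupS pP; rewrite -(minM' (P :&: M)%G) ?subsetIl ?subsetIr //=.
  by rewrite ntPM normsI // normal_norm.
have goodGP : sqf_above (G / 'Phi(G))%G 1.
  apply: sqf_above_sub (sqf_above_quotient nsPG (Phi_sub G) goodG).
  by rewrite /= trivg_quotient.
move=> N nsNG _ not_sGN.
(* Only the bottom of [G] is left, where [M] itself is the required factor. *)
have [-> | ntN] := eqVneq N 1%G; last exact: (quo_good N).
by exists M; apply: (sqf_above_minnormal goodGP p_pr).
Qed.

(** * The class of strongly supersoluble groups *)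

Lemma strongly_supersoluble_isog : isog_closed strongly_supersoluble.
Proof.
move=> gT rT G H /isogP[f _ imf] /strongly_supersolubleP goodG.
have eqH : (f @* G)%G = H by apply: val_inj.
apply/strongly_supersolubleP; rewrite -eqH.
apply: sqf_above_sub (sqf_above_morphim (subxx G) (sub1G G) goodG).
by rewrite /= morphim1.
Qed.

Lemma strongly_supersolubleS (gT : finGroupType) (G H : {group gT}) :
  H \subset G -> strongly_supersoluble G -> strongly_supersoluble H.
Proof.
by move=> sHG /strongly_supersolubleP/(sqf_aboveS sHG)/strongly_supersolubleP.
Qed.

Lemma strongly_supersoluble_quotient (gT : finGroupType) (G N : {group gT}) :
  N <| G -> strongly_supersoluble G -> strongly_supersoluble (G / N)%G.
Proof.
move=> nsNG /strongly_supersolubleP/(sqf_above1_quotient nsNG).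
by move/strongly_supersolubleP.
Qed.

Lemma strongly_supersoluble_quotientP (gT : finGroupType) (G N : {group gT}) :
  N <| G -> strongly_supersoluble (G / N)%G <-> sqf_above G N.
Proof.
move=> nsNG; split=> [/strongly_supersolubleP goodGN | goodG].
  apply: (sqf_above_quotient_inv nsNG (subxx N)).
  exact: sqf_above_sub (sub1G _) goodGN.
apply/strongly_supersolubleP.
apply: sqf_above_sub (sqf_above_quotient nsNG (normal_sub nsNG) goodG).
by rewrite /= trivg_quotient.
Qed.

Lemma strongly_supersoluble_quotientI (gT : finGroupType) (G A B : {group gT}) :
    A <| G -> B <| G ->
    strongly_supersoluble (G / A)%G -> strongly_supersoluble (G / B)%G ->
  strongly_supersoluble (G / (A :&: B))%G.
Proof.
move=> nsAG nsBG /(strongly_supersoluble_quotientP nsAG) goodA.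
move=> /(strongly_supersoluble_quotientP nsBG) goodB.
apply/(@strongly_supersoluble_quotientP _ G (A :&: B)%G); first exact: normalI.
exact: sqf_above_setI.
Qed.

Lemma strongly_supersoluble_Phi : saturated strongly_supersoluble.
Proof.
move=> gT G /(strongly_supersoluble_quotientP (Phi_normal G)) goodG.
exact/strongly_supersolubleP/sqf_above_Phi.
Qed.

(** [K / H1] and [K / H2] are isomorphic to [H2] and [H1], and the two kernels meet trivially, so
    this is an instance of closure under subdirect products. *)
Lemma strongly_supersoluble_dprod (gT : finGroupType) (H1 H2 K : {group gT}) :
    H1 \x H2 = K -> strongly_supersoluble H1 -> strongly_supersoluble H2 ->
  strongly_supersoluble K.
Proof.
move=> defK ssH1 ssH2; have [nsH1K nsH2K] := dprod_normal2 defK.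
have [_ mulK cH12 tiH12] := dprodP defK.
have eqI : (H1 :&: H2)%G = 1%G by apply: val_inj.
apply/strongly_supersolubleP; rewrite -eqI.
apply: sqf_above_setI => //; apply/strongly_supersoluble_quotientP => //.
  have -> : (K / H1)%G = (H2 / H1)%G.
    by apply: val_inj; rewrite /= -mulK quotientMidl.
  apply: strongly_supersoluble_isog ssH2; apply: quotient_isog => //.
  by apply: cents_norm.
have -> : (K / H2)%G = (H1 / H2)%G.
  by apply: val_inj; rewrite /= -mulK quotientMidr.
apply: strongly_supersoluble_isog ssH1; apply: quotient_isog.
  by apply: cents_norm; rewrite centsC.
by rewrite setIC.
Qed.

Theorem theorem2p5 (gT : finGroupType) (G : {group gT}) :
  (strongly_supersoluble G ->
     forall H : {group gT}, H \subset G -> strongly_supersoluble H)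
  /\ (forall N : {group gT},
        strongly_supersoluble G -> N <| G -> strongly_supersoluble (G / N)%G)
  /\ (forall N1 N2 : {group gT},
        N1 <| G -> N2 <| G ->
        strongly_supersoluble (G / N1)%G -> strongly_supersoluble (G / N2)%G ->
        strongly_supersoluble (G / (N1 :&: N2))%G)
  /\ (forall H1 H2 : {group gT},
        H1 <| G -> H2 <| G ->
        strongly_supersoluble H1 -> strongly_supersoluble H2 ->
        H1 :&: H2 = 1 ->
        exists2 K : {group gT}, H1 \x H2 = K & strongly_supersoluble K)
  /\ (strongly_supersoluble (G / 'Phi(G))%G -> strongly_supersoluble G)
  /\ [/\ formation strongly_supersoluble, hereditary strongly_supersoluble
       & saturated strongly_supersoluble].
Proof.
split; first by move=> ssG H sHG; apply: strongly_supersolubleS ssG.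
split; first by move=> N ssG nsNG; apply: strongly_supersoluble_quotient.
split; first by move=> N1 N2; apply: strongly_supersoluble_quotientI.
split.
  move=> H1 H2 nsH1 nsH2 ss1 ss2 ti12.
  have cH12 : H2 \subset 'C(H1).
    rewrite centsC; apply/commG1P/trivgP; rewrite -ti12 subsetI.
    have [[sH1G nH1G] [sH2G nH2G]] := (andP nsH1, andP nsH2).
    by rewrite commg_subl commg_subr (subset_trans sH2G) ?(subset_trans sH1G).
  have defK : H1 \x H2 = (H1 <*> H2)%G by rewrite dprodEY.
  exists (H1 <*> H2)%G => //.
  by apply: strongly_supersoluble_dprod defK ss1 ss2.
split; first exact: strongly_supersoluble_Phi.
split; last exact: strongly_supersoluble_Phi.
- split; first exact: strongly_supersoluble_isog.
  + exact: strongly_supersoluble_quotient.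
  + exact: strongly_supersoluble_quotientI.
- by move=> rT H K; apply: strongly_supersolubleS.
Qed.
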